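(* Let $n\ge1$. For every $m\ge0$, $$\dim\mathscr V_m^{(n)}=\binom{m+2n}{2n}+\binom{m+2n-2}{2n}$$ and $$\dim\mathscr W_m^{(n)}=\binom{m+2n-1}{2n-1}+\binom{m+2n-3}{2n-1}.$$ Equivalently, as formal power series, $$\sum_{m=0}^\infty(\dim\mathscr W_m^{(n)})\,q^m=\frac{1+q^2}{(1-q)^{2n}}.$$ In particular, for $n=1$, $\dim\mathscr V_m^{(1)}=m^2+m+1$, while $\dim\mathscr W_0^{(1)}=1$ and $\dim\mathscr W_m^{(1)}=2m$ for $m\ge1$.
   Context: $\mathbb H^n=\mathbb R^{2n}\times\mathbb R$ with dilations $\delta_r(z,t)=(rz,r^2t)$, $r>0$. $P_m(\mathbb H^n)$ is the space of polynomials $p$ in the $2n+1$ real coordinates, with complex coefficients, such that $p\circ\delta_r=r^mp$ for all $r>0$. $\rho(z,t)=(|z|^4+t^2)^{1/4}$, $S_\rho^{(n)}=\{\rho=1\}$. The measure $\sigma_n$ on $S_\rho^{(n)}$ is the finite measure determined by $\int f\,dz\,dt=\int_0^\infty\int_{S_\rho^{(n)}}f(\delta_s\omega)\,s^{2n+1}\,d\sigma_n(\omega)\,ds$ (Lebesgue measure on the left). $\mathscr A_m^{(n)}=\bigoplus_{j=0}^mP_j(\mathbb H^n)$, $\mathscr V_m^{(n)}=\{p|_{S_\rho^{(n)}}:p\in\mathscr A_m^{(n)}\}$, and $\mathscr W_m^{(n)}=\mathscr V_m^{(n)}\cap(\mathscr V_{m-1}^{(n)})^\perp$ with orthogonality in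 $L^2(S_\rho^{(n)},\sigma_n)$; $\mathscr A_m^{(n)}=\mathscr V_m^{(n)}=\{0\}$ for $m<0$. Binomial coefficients $\binom{a}{b}$ with $b\ge0$ and integer $a<b$ (including $a<0$) are interpreted as $0$. *)

(* Defs.v *)
From HB Require Import structures.
From mathcomp Require Import all_boot all_order all_algebra.
From mathcomp Require Import complex.
From mathcomp Require Import -(notations) mpoly.
From mathcomp Require Import all_classical all_reals all_analysis.
From mathcomp Require Import measurable_realfun.

Set Implicit Arguments.
Unset Strict Implicit.
Unset Printing Implicit Defensive.
Set Warnings "-notation-overridden".

Import Order.TTheory GRing.Theory Num.Theory.
Import numFieldNormedType.Exports.

Local Open Scope classical_set_scope.
Local Open Scope ring_scope.
Local Open Scope complex_scope.

Section Dimension.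
Context {K : fieldType} {V : lmodType K}.

Definition is_basis (U : set V) (d : nat) (e : 'I_d -> V) : Prop :=
  (forall c : 'I_d -> K, \sum_(i < d) c i *: e i = 0 -> forall i, c i = 0) /\
  U = [set \sum_(i < d) c i *: e i | c in [set: 'I_d -> K]].

Definition has_dim (U : set V) (d : nat) : Prop :=
  exists e : 'I_d -> V, is_basis U e.

(* Takes the value 0 when U is not a finite-dimensional subspace. *)
Definition vdim (U : set V) : nat := xget 0%N [set d | has_dim U d].

Lemma has_dim_le (U : set V) (d d' : nat) :
  has_dim U d -> has_dim U d' -> (d <= d')%N.
Proof.
move=> [e [eI eU]] [e' [_ e'U]].
have eP j : exists c : 'I_d' -> K, e j = \sum_(i < d') c i *: e' i.
  have : U (e j).
    rewrite eU; exists (fun i => (i == j)%:R) => //.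
    rewrite (bigD1 j)//= eqxx scale1r big1 ?addr0// => i /negPf ->.
    by rewrite scale0r.
  by rewrite e'U => -[c _ <-]; exists c.
have {eP} [A eA] := choice eP.
pose M : 'M[K]_(d, d') := \matrix_(j, i) A j i.
suff /eqP <- : row_free M by exact: rank_leq_col.
rewrite -kermx_eq0; apply/eqP/matrixP => k j; rewrite [RHS]mxE.
apply: (eI (fun j => kermx M k j)).
under eq_bigr do rewrite eA scaler_sumr.
rewrite exchange_big big1 //= => i _.
under eq_bigr do rewrite scalerA.
rewrite -scaler_suml.
have /matrixP/(_ k i) := mulmx_ker M; rewrite [LHS]mxE [RHS]mxE => kM.
suff -> : \sum_(j < d) kermx M k j * A j i = 0 by rewrite scale0r.
by rewrite -[RHS]kM; apply: eq_bigr => l _; rewrite [M l i]mxE.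
Qed.

Lemma has_dim_vdim (U : set V) (d : nat) : has_dim U d -> vdim U = d.
Proof.
move=> Ud; have Uv : has_dim U (vdim U) by apply: (xgetPex 0%N); exists d.
by apply/eqP; rewrite eqn_leq (has_dim_le Uv Ud) (has_dim_le Ud Uv).
Qed.

End Dimension.

Record fps (R : Type) := Fps { fps_coef : nat -> R }.

HB.instance Definition _ (R : Type) := gen_eqMixin (fps R).
HB.instance Definition _ (R : Type) := gen_choiceMixin (fps R).

Section FormalPowerSeries.
Context {R : comUnitRingType}.
Implicit Types f g h : fps R.

Lemma fpsP f g : fps_coef f =1 fps_coef g -> f = g.
Proof. by case: f g => [f] [g] /funext /= ->. Qed.

Definition fps_zero : fps R := Fps (fun=> 0).
Definition fps_opp f := Fps (fun n => - fps_coef f n).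
Definition fps_add f g := Fps (fun n => fps_coef f n + fps_coef g n).

Fact fps_addA : associative fps_add.
Proof. by move=> f g h; apply: fpsP => n /=; rewrite addrA. Qed.
Fact fps_addC : commutative fps_add.
Proof. by move=> f g; apply: fpsP => n /=; rewrite addrC. Qed.
Fact fps_add0 : left_id fps_zero fps_add.
Proof. by move=> f; apply: fpsP => n /=; rewrite add0r. Qed.
Fact fps_addN : left_inverse fps_zero fps_opp fps_add.
Proof. by move=> f; apply: fpsP => n /=; rewrite addNr. Qed.

HB.instance Definition _ :=
  GRing.isZmodule.Build (fps R) fps_addA fps_addC fps_add0 fps_addN.

Definition fps_one : fps R := Fps (fun n => (n == 0%N)%:R).
Definition fps_mul f g :=
  Fps (fun n => \sum_(i < n.+1) fps_coef f i * fps_coef g (n - i)).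

Definition fps_trunc n f : {poly R} := \poly_(i < n) fps_coef f i.

Lemma fps_mul_trunc f g n k : (n < k)%N ->
  fps_coef (fps_mul f g) n = (fps_trunc k f * fps_trunc k g)`_n.
Proof.
move=> nk; rewrite coefM; apply: eq_bigr => i _.
have ik : (i < k)%N by apply: leq_trans nk; exact: ltn_ord.
have nik : (n - i < k)%N by apply: leq_ltn_trans nk; exact: leq_subr.
by rewrite !coef_poly ik nik.
Qed.

Fact fps_mulA : associative fps_mul.
Proof.
move=> f g h; apply: fpsP => n.
have truncE u v : fps_coef (fps_mul u (fps_mul v h)) n =
    (fps_trunc n.+1 u * (fps_trunc n.+1 v * fps_trunc n.+1 h))`_n.
  rewrite coefM; apply: eq_bigr => i _.
  by rewrite coef_poly ltn_ord (@fps_mul_trunc _ _ _ n.+1) ?ltnS ?leq_subr.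
rewrite truncE mulrA coefM; apply: eq_bigr => i _.
by rewrite (@fps_mul_trunc _ _ _ n.+1)// coef_poly ltnS leq_subr.
Qed.

Fact fps_mulC : commutative fps_mul.
Proof.
by move=> f g; apply: fpsP => n; rewrite !(@fps_mul_trunc _ _ _ n.+1)// mulrC.
Qed.

Fact fps_mul1 : left_id fps_one fps_mul.
Proof.
move=> f; apply: fpsP => n /=.
by rewrite big_ord_recl /= mul1r subn0 big1 ?addr0// => i _; rewrite mul0r.
Qed.

Fact fps_mulDl : left_distributive fps_mul fps_add.
Proof.
move=> f g h; apply: fpsP => n /=; rewrite -big_split /=.
by apply: eq_bigr => i _; rewrite mulrDl.
Qed.

Fact fps_oner_neq0 : fps_one != 0.
Proof.
apply/eqP => /(congr1 (fun f => fps_coef f 0%N)) /= /eqP.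
by rewrite oner_eq0.
Qed.

HB.instance Definition _ := GRing.Zmodule_isComNzRing.Build (fps R)
  fps_mulA fps_mulC fps_mul1 fps_mulDl fps_oner_neq0.

Lemma fps_coefD f g n : fps_coef (f + g) n = fps_coef f n + fps_coef g n.
Proof. by []. Qed.
Lemma fps_coefN f n : fps_coef (- f) n = - fps_coef f n.
Proof. by []. Qed.
Lemma fps_coef1 n : fps_coef (1 : fps R) n = (n == 0%N)%:R.
Proof. by []. Qed.
Lemma fps_coefM f g n :
  fps_coef (f * g) n = \sum_(i < n.+1) fps_coef f i * fps_coef g (n - i).
Proof. by []. Qed.

Definition fps_X : fps R := Fps (fun n => (n == 1%N)%:R).

Definition fps_unit : {pred fps R} :=
  [pred f | fps_coef f 0%N \is a GRing.unit].

(* With a = f_0 a unit, the inverse is a^-1 * \sum_k (1 - a^-1 f)^k; only the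
   terms with k <= n contribute to the coefficient of index n. *)
Definition fps_geom f : fps R :=
  1 - Fps (fun n => (fps_coef f 0%N)^-1 * fps_coef f n).
Definition fps_inv f : fps R :=
  if f \in fps_unit then
    Fps (fun n => (fps_coef f 0%N)^-1 *
                  fps_coef (\sum_(k < n.+1) fps_geom f ^+ k) n)
  else f.

Lemma fps_expr_coef0 f n k :
  fps_coef f 0%N = 0 -> (n < k)%N -> fps_coef (f ^+ k) n = 0.
Proof.
move=> f0; elim: k n => // k IH n nk; rewrite exprS fps_coefM big1// => i _.
have [->|i0] := eqVneq (i : nat) 0%N; first by rewrite f0 mul0r.
rewrite IH ?mulr0// ltn_subLR; last by rewrite -ltnS.
by rewrite (leq_trans nk)// -[k.+1]add1n leq_add2r lt0n.
Qed.

Fact fps_mulVx : {in fps_unit, left_inverse 1 fps_inv *%R}.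
Proof.
move=> f fU; have aU : fps_coef f 0%N \is a GRing.unit := fU.
set a := fps_coef f 0%N in aU; rewrite mulrC; apply: fpsP => n.
pose g := fps_geom f.
have g0 : fps_coef g 0%N = 0.
  by rewrite /g /fps_geom fps_coefD fps_coefN fps_coef1 /= mulVr ?subrr.
have sumE m : (m <= n)%N -> fps_coef (\sum_(k < m.+1) g ^+ k) m =
    fps_coef (\sum_(k < n.+1) g ^+ k) m.
  have cD : forall r (F : nat -> fps R),
      fps_coef (\sum_(k < r) F k) m = \sum_(k < r) fps_coef (F k) m.
    move=> r F; elim: r => [|r IH]; first by rewrite !big_ord0.
    by rewrite !big_ord_recr fps_coefD IH.
  move=> mn; rewrite !cD [RHS](bigID (fun k : 'I_n.+1 => k < m.+1)%N) /=.
  rewrite [X in _ = _ + X]big1 ?addr0; last first.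
    by move=> k; rewrite -leqNgt => mk; rewrite fps_expr_coef0.
  exact: (big_ord_widen n.+1 (fun k => fps_coef (g ^+ k) m)).
transitivity (fps_coef ((1 - g) * \sum_(k < n.+1) g ^+ k) n).
  rewrite !fps_coefM; apply: eq_bigr => i _.
  rewrite /fps_inv fU /= -/g -/a (sumE _ (leq_subr _ _)) mulrA; congr (_ * _).
  by rewrite /g /fps_geom subKr /= -/a mulrC.
have -> : (1 - g) * \sum_(k < n.+1) g ^+ k = 1 - g ^+ n.+1.
  rewrite -[in RHS](expr1n _ n.+1) subrXX; congr (_ * _).
  by apply: eq_bigr => k _; rewrite expr1n mul1r.
by rewrite fps_coefD fps_coefN fps_expr_coef0// subr0.
Qed.

Fact fps_unitPl f g : g * f = 1 -> fps_unit f.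
Proof.
move/(congr1 (fun h => fps_coef h 0%N)).
rewrite fps_coefM big_ord1 fps_coef1 /= => gf.
by apply/unitrP; exists (fps_coef g 0%N); split => //; rewrite mulrC.
Qed.

Fact fps_invr_out : {in [predC fps_unit], fps_inv =1 id}.
Proof. by move=> f; rewrite inE /= /fps_inv => /negPf ->. Qed.

HB.instance Definition _ := GRing.ComNzRing_hasMulInverse.Build (fps R)
  fps_mulVx fps_unitPl fps_invr_out.

End FormalPowerSeries.

Notation "''q'" := fps_X (at level 0) : ring_scope.

Definition binz (a : int) (b : nat) : nat :=
  if a is Posz k then 'C(k, b) else 0%N.

Section TupleLebesgue.
Variable R : realType.

Definition tcons k (p : k.-tuple R * R) : k.+1.-tuple R :=
  [the k.+1.-tuple R of p.2 :: p.1].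

Lemma measurable_tcons k : measurable_fun [set: k.-tuple R * R] (@tcons k).
Proof. by apply: measurable_cons. Qed.

Fixpoint tuple_lebesgue (k : nat) : set (k.-tuple R) -> \bar R :=
  match k with
  | 0 => dirac [tuple]
  | k'.+1 => pushforward (@tuple_lebesgue k' \x lebesgue_measure)%E (@tcons k')
  end.
Arguments tuple_lebesgue : clear implicits.

Lemma tuple_lebesgue_is_measure k :
  exists m : {measure set (k.-tuple R) -> \bar R}, tuple_lebesgue k = m.
Proof.
elim: k => [|k [m mE]]; first by exists (dirac [tuple]).
exists (measure_function_pushforward__canonical__measure_function_Measure
  (m \x lebesgue_measure)%E (@measurable_tcons k)).
by rewrite /= mE.
Qed.

Fact tuple_lebesgue0 k : tuple_lebesgue k set0 = 0%E.
Proof. by have [m ->] := tuple_lebesgue_is_measure k; rewrite measure0. Qed.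

Fact tuple_lebesgue_ge0 k A : (0 <= tuple_lebesgue k A)%E.
Proof. by have [m ->] := tuple_lebesgue_is_measure k; exact: measure_ge0. Qed.

Fact tuple_lebesgue_sigma_additive k : semi_sigma_additive (tuple_lebesgue k).
Proof.
have [m ->] := tuple_lebesgue_is_measure k.
exact: measure_semi_sigma_additive.
Qed.

HB.instance Definition _ k := isMeasure.Build _ _ _ (tuple_lebesgue k)
  (@tuple_lebesgue0 k) (@tuple_lebesgue_ge0 k)
  (@tuple_lebesgue_sigma_additive k).

End TupleLebesgue.
Arguments tuple_lebesgue : clear implicits.

Notation heis R n := ((2 * n)%N.-tuple R * R)%type.

Section Heisenberg.
Context {R : realType}.

Definition heis_lebesgue (n : nat) : set (heis R n) -> \bar R :=
  (tuple_lebesgue R (2 * n) \x lebesgue_measure)%E.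

Section HeisLebesgueMeasure.
Variable n : nat.
(* The same set function over the g_sigma_algebraType copy of R, which is not
   unified with R as a measurableType. *)
Let m : {measure set ((2 * n).-tuple R * measurableTypeR R) -> \bar R} :=
  [the measure _ _ of (tuple_lebesgue R (2 * n) \x @lebesgue_measure R)%E].

Fact heis_lebesgue0 : @heis_lebesgue n set0 = 0%E.
Proof. exact: (measure0 m). Qed.

Fact heis_lebesgue_ge0 A : (0 <= @heis_lebesgue n A)%E.
Proof. exact: (measure_ge0 m). Qed.

Fact heis_lebesgue_sigma_additive : semi_sigma_additive (@heis_lebesgue n).
Proof. exact: (@measure_semi_sigma_additive _ _ _ m). Qed.

HB.instance Definition _ := isMeasure.Build _ _ _ (@heis_lebesgue n)
  heis_lebesgue0 heis_lebesgue_ge0 heis_lebesgue_sigma_additive.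

End HeisLebesgueMeasure.

Definition dilation n (r : R) (x : heis R n) : heis R n :=
  ([tuple of [seq r * c | c <- x.1]], r ^+ 2 * x.2).

Definition enorm k (z : k.-tuple R) : R :=
  Num.sqrt (\sum_(i < k) tnth z i ^+ 2).

Definition rho n (x : heis R n) : R :=
  (enorm x.1 ^+ 4 + x.2 ^+ 2) `^ (4^-1).

Definition Srho n := {x : heis R n | rho x == 1}.

Definition srho_val n (w : Srho n) : heis R n := val w.

Fact rho_pole n : rho (([tuple of nseq (2 * n) 0], 1) : heis R n) == 1.
Proof.
rewrite /rho /enorm /= big1 => [|i _].
  by rewrite sqrtr0 expr0n /= add0r expr1n powR1.
by rewrite (tnth_nth 0) /= nth_nseq ltn_ord expr0n.
Qed.

HB.instance Definition _ n := gen_eqMixin (Srho n).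
HB.instance Definition _ n := gen_choiceMixin (Srho n).
HB.instance Definition _ n :=
  isPointed.Build (Srho n)
    (exist (fun x : heis R n => rho x == 1) _ (rho_pole n)).
(* The trace on the sphere of the Borel sigma-algebra of R^{2n} x R. *)
HB.instance Definition _ n :=
  Measurable.copy (Srho n) (g_sigma_algebra_preimageType (@srho_val n)).

Definition is_polar_measure n (sigma : {finite_measure set (Srho n) -> \bar R})
    : Prop :=
  forall f : heis R n -> \bar R,
    measurable_fun [set: heis R n] f -> (forall x, (0 <= f x)%E) ->
    (\int[@heis_lebesgue n]_x f x =
     \int[@lebesgue_measure R]_(s in `]0%R, +oo[)
       \int[sigma]_w (f (dilation s (srho_val w)) * (s ^+ (2 * n).+1)%:E))%E.

(* The variables with index < 2n are the coordinates of z; the last one is t. *)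
Notation cpoly n := (mpoly (2 * n).+1 R[i]).

Definition peval n (p : cpoly n) (x : heis R n) : R[i] :=
  meval (fun i => (tnth [the (2 * n).+1.-tuple R of rcons x.1 x.2] i)%:C)
    p.

Definition homog n (m : nat) : set (cpoly n) :=
  [set p | forall r : R, 0 < r ->
           forall x, peval p (dilation r x) = (r ^+ m)%:C * peval p x].

Definition polA n (m : int) : set (cpoly n) :=
  match m with
  | Posz k => [set \sum_(j < k.+1) p j |
                p in [set p : nat -> cpoly n | forall j, homog j (p j)]]
  | Negz _ => [set 0]
  end.

Definition restr n (p : cpoly n) : Srho n -> R[i]^o :=
  fun w => peval p (srho_val w).

Definition spaceV n (m : int) : set (Srho n -> R[i]^o) :=
  [set restr p | p in polA m].

Section Orthogonality.
Variables (n : nat) (sigma : {finite_measure set (Srho n) -> \bar R}).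

Definition cintegral (f : Srho n -> R[i]) : R[i] :=
  (\int[sigma]_w complex.Re (f w))%R +i* (\int[sigma]_w complex.Im (f w))%R.

Definition inner (f g : Srho n -> R[i]) : R[i] :=
  cintegral (fun w => f w * (g w)^*).

Definition spaceW (m : int) : set (Srho n -> R[i]^o) :=
  @spaceV n m `&` [set f | forall g, @spaceV n (m - 1) g -> inner f g = 0].

End Orthogonality.

End Heisenberg.

Arguments spaceV R n m : clear implicits.
Arguments spaceW {R n} sigma m.
Arguments Srho R n : clear implicits.

(* Main.v *)
Require Import Defs.
From mathcomp Require Import all_boot all_order all_algebra.
From mathcomp Require Import complex.
From mathcomp Require Import -(notations) mpoly.
From mathcomp Require Import all_classical all_reals all_analysis.
From mathcomp Require Import measurable_realfun.
From mathcomp Require Import ring zify.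

(** On the sphere [rho = 1] the identity [t ^ 2 = 1 - |z| ^ 4] holds, and it
    relates monomials of equal weighted degree up to lower ones: [z ^ a t ^ e]
    has degree [|a| + 2 e], and [|z| ^ 4] has the degree 4 of [t ^ 2].  Hence
    every restricted polynomial of degree at most [m] is a combination of the
    monomials [z ^ a t ^ e] with [e = 0] or [1] and [|a| + 2 e <= m]
    ([spaceV_span]).  These are independent on the sphere ([smon_free]): if
    [u(z) + t v(z)] vanishes there, the reflection [t -> - t] shows that [u]
    and [t v] vanish; as the sphere lies over the unit ball, with [t != 0]
    over the open ball, the polynomials [u] and [v] are zero on an open set.
    Counting exponents gives the dimension of [V_m].

    For [W_m] it suffices that the inner product is definite on [V_m]: then
    [dim W_m = dim V_m - dim V_(m-1)] ([has_dim_orthocompl]), and Pascal's rule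
    evaluates the difference.  Definiteness holds because [sigma] charges
    the open set where a nonzero restricted polynomial does not vanish.  If [f]
    in [V_m] has norm 0, multiplying each of its monomials by the power of
    [rho] that brings its degree to [m] extends [f] to a continuous function
    [F], homogeneous of degree [m]; by the polar formula [|F| ^ 2] has Lebesgue
    integral 0, so that [F] is zero everywhere ([nonneg_integral_eq0],
    [polar_sqr_integral_eq0]).

    The generating function follows from the binomial series
    [\sum_m 'C(m + b, b) q ^ m = (1 - q) ^ (- b - 1)] with [b = 2 n - 1]. *)

Set Implicit Arguments.
Unset Strict Implicit.
Unset Printing Implicit Defensive.

Import Order.TTheory GRing.Theory Num.Theory.
Import numFieldNormedType.Exports.

Local Open Scope classical_set_scope.
Local Open Scope ring_scope.

(** * Dimensions of subspaces and of orthogonal complements *)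

Lemma has_dim_fin (K : fieldType) (V : lmodType K) (I : finType) (e : I -> V)
    (U : set V) :
  (forall c : I -> K, \sum_i c i *: e i = 0 -> forall i, c i = 0) ->
  (forall f, U f <-> exists c : I -> K, f = \sum_i c i *: e i) ->
  has_dim U #|I|.
Proof.
move=> eI eU; exists (e \o enum_val); split.
  move=> c c0 i.
  rewrite -(enum_valK i); apply: (eI (c \o enum_rank)).
  rewrite (reindex (@enum_val I I)) /=; last exact/onW_bij/enum_val_bij.
  by under eq_bigr do rewrite enum_valK.
apply/seteqP; split => f.
  move=> /eU[c ->]; exists (c \o enum_val) => //.
  by rewrite [RHS](reindex (@enum_val I I)) //=; exact/onW_bij/enum_val_bij.
move=> [c _ <-]; apply/eU; exists (c \o enum_rank).
rewrite [RHS](reindex (@enum_val I I)) /=; last exact/onW_bij/enum_val_bij.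
by under [RHS]eq_bigr do rewrite enum_valK.
Qed.

Lemma is_basisP (K : fieldType) (V : lmodType K) (U : set V) d (e : 'I_d -> V) :
  is_basis U e -> forall f, U f <-> exists x : 'rV[K]_d, f = \sum_i x 0 i *: e i.
Proof.
move=> [_ ->] f; split=> [[c _ <-]|[x ->]]; last by exists (x 0).
by exists (\row_i c i); apply: eq_bigr => i _; rewrite mxE.
Qed.

Section OrthogonalComplement.
Context {K : fieldType} {V : lmodType K} (s : {rmorphism K -> K}).
Variables (U U' : set V) (d d' : nat) (B : V -> V -> K).
Hypotheses (dimU : has_dim U d) (dimU' : has_dim U' d') (U'U : U' `<=` U).
Hypothesis Bl : forall a f f' g, U f -> U f' -> U' g ->
  B (a *: f + f') g = a * B f g + B f' g.
Hypothesis Br : forall a f g g', U f -> U' g -> U' g' ->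
  B f (a *: g + g') = s a * B f g + B f g'.
Hypothesis Bdef : forall f, U' f -> B f f = 0 -> f = 0.

Let linU W k (e : 'I_k -> V) : is_basis W e ->
  W 0 /\ forall a f g, W f -> W g -> W (a *: f + g).
Proof.
move=> eb; have eP := is_basisP eb; split=> [|a f g].
  by apply/eP; exists 0; rewrite big1 // => i _; rewrite mxE scale0r.
move=> /eP[x ->] /eP[y ->]; apply/eP; exists (a *: x + y).
rewrite scaler_sumr -big_split; apply: eq_bigr => i _.
by rewrite !mxE scalerDl scalerA.
Qed.

Let B_suml I (r : seq I) (c : I -> K) (F : I -> V) g : (forall i, U (F i)) ->
  U' g -> B (\sum_(i <- r) c i *: F i) g = \sum_(i <- r) c i * B (F i) g.
Proof.
move=> UF U'g; have [e eb] := dimU; have [U0 UD] := linU eb.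
have B0 : B 0 g = 0.
  have := @Bl 1 0 0 g U0 U0 U'g; rewrite scaler0 addr0 mul1r.
  by move/eqP; rewrite -subr_eq subrr eq_sym => /eqP.
suff [] : U (\sum_(i <- r) c i *: F i) /\
  B (\sum_(i <- r) c i *: F i) g = \sum_(i <- r) c i * B (F i) g by [].
elim: r => [|i r [IHU IH]]; first by rewrite !big_nil.
by rewrite !big_cons Bl // IH; split => //; exact: UD.
Qed.

Let B_sumr I (r : seq I) (c : I -> K) (F : I -> V) f : (forall i, U' (F i)) ->
  U f -> B f (\sum_(i <- r) c i *: F i) = \sum_(i <- r) s (c i) * B f (F i).
Proof.
move=> UF Uf; have [e eb] := dimU'; have [U0 UD] := linU eb.
have B0 : B f 0 = 0.
  have := @Br 1 f 0 0 Uf U0 U0; rewrite scaler0 addr0 rmorph1 mul1r.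
  by move/eqP; rewrite -subr_eq subrr eq_sym => /eqP.
suff [] : U' (\sum_(i <- r) c i *: F i) /\
  B f (\sum_(i <- r) c i *: F i) = \sum_(i <- r) s (c i) * B f (F i) by [].
elim: r => [|i r [IHU IH]]; first by rewrite !big_nil.
by rewrite !big_cons Br // IH; split => //; exact: UD.
Qed.

(** In terms of bases of [U] and [U'] the complement is the left kernel of
    the matrix of [B].  Definiteness on [U'] makes the Gram matrix of [U']
    invertible; it factors through the matrix of [B], which therefore has full
    column rank [d']. *)
Lemma has_dim_orthocompl :
  has_dim (U `&` [set f | forall g, U' g -> B f g = 0]) (d - d').
Proof.
have [e eb] := dimU; have [e' eb'] := dimU'.
have eP := is_basisP eb; have eP' := is_basisP eb'.
have Ue i : U (e i).
  by apply/eP; exists (delta_mx 0 i); rewrite (bigD1 i) //= big1 ?mxE ?eqxx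
    ?scale1r ?addr0 // => j /negPf ji; rewrite mxE ji andbF scale0r.
have Ue' i : U' (e' i).
  by apply/eP'; exists (delta_mx 0 i); rewrite (bigD1 i) //= big1 ?mxE ?eqxx
    ?scale1r ?addr0 // => j /negPf ji; rewrite mxE ji andbF scale0r.
have UUe' i : U (e' i) := U'U (Ue' i).
pose M : 'M[K]_(d, d') := \matrix_(i, j) B (e i) (e' j).
have BM (x : 'rV[K]_d) j : B (\sum_i x 0 i *: e i) (e' j) = (x *m M) 0 j.
  by rewrite B_suml // !mxE; apply: eq_bigr => i _; rewrite mxE.
have orthP f (x : 'rV_d) : f = \sum_i x 0 i *: e i ->
    (forall g, U' g -> B f g = 0) <-> x *m M = 0.
  move=> fx; have Uf : U f by apply/eP; exists x.
  split=> [f0|xM g /eP'[y ->]].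
    by apply/rowP => j; rewrite -BM -fx mxE; exact: f0.
  by rewrite B_sumr // big1 // => j _; rewrite fx BM xM mxE mulr0.
have rkM : \rank M = d'.
  have /choice[A eA] : forall j, exists x : 'rV[K]_d, e' j = \sum_i x 0 i *: e i.
    by move=> j; apply/eP/U'U.
  apply/eqP; rewrite eqn_leq rank_leq_col /=.
  pose G := (\matrix_j A j) *m M.
  suff /eqP rkG : row_free G by rewrite -[leqLHS]rkG mxrankM_maxr.
  rewrite -kermx_eq0; apply/eqP/row_matrixP => k; rewrite row0.
  set x := row k _; have xG : x *m G = 0 by rewrite -row_mul mulmx_ker row0.
  have GE i j : G i j = B (e' i) (e' j).
    rewrite (eA i) BM !mxE; apply: eq_bigr => l _.
    by rewrite !mxE.
  have Bf j : B (\sum_i x 0 i *: e' i) (e' j) = 0.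
    have /matrixP/(_ 0 j) := xG; rewrite mxE [RHS]mxE => <-.
    by rewrite (B_suml _ _ UUe') //; apply: eq_bigr => i _; rewrite GE.
  have U'f : U' (\sum_i x 0 i *: e' i) by apply/eP'; exists x.
  have /Bdef : B (\sum_i x 0 i *: e' i) (\sum_i x 0 i *: e' i) = 0.
    rewrite (B_sumr _ _ Ue'); last exact: U'U.
    by rewrite big1 // => i _; rewrite Bf mulr0.
  move=> /(_ U'f) f0; apply/rowP => i; rewrite [RHS]mxE.
  by have [eI _] := eb'; exact: (eI (x 0)).
rewrite -rkM -mxrank_ker.
pose N := row_base (kermx M).
have wE (y : 'rV_(\rank (kermx M))) :
    \sum_k y 0 k *: (\sum_i N k i *: e i) = \sum_i (y *m N) 0 i *: e i.
  under eq_bigr do rewrite scaler_sumr; rewrite exchange_big.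
  apply: eq_bigr => i _; rewrite mxE scaler_suml.
  by apply: eq_bigr => k _; rewrite scalerA.
exists (fun k => \sum_i N k i *: e i); split=> [c|].
  have -> : \sum_k c k *: (\sum_i N k i *: e i) =
      \sum_i ((\row_k c k) *m N) 0 i *: e i.
    by rewrite -wE; apply: eq_bigr => k _; rewrite mxE.
  have [eI _] := eb => /eI cN k.
  have : (\row_k c k) *m N = 0 by apply/rowP => i; rewrite cN mxE.
  move/(congr1 (mulmxr (pinvmx N))) => /=.
  by rewrite mul0mx mulmxKp ?row_base_free // => /rowP/(_ k); rewrite !mxE.
apply/seteqP; split => [f [/eP[x fx] /(orthP _ _ fx)/eqP]|f [c _ <-]].
  rewrite -sub_kermx -(eq_row_base (kermx M)) => /submxP[y xy].
  by exists (y 0) => //; rewrite wE fx xy.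
have cE : \sum_k c k *: (\sum_i N k i *: e i) =
    \sum_i ((\row_k c k) *m N) 0 i *: e i.
  by rewrite -wE; apply: eq_bigr => k _; rewrite mxE.
split; first by apply/eP; exists ((\row_k c k) *m N).
apply/(orthP _ _ cE)/eqP; rewrite -sub_kermx -(eq_row_base (kermx M)).
exact: submxMl.
Qed.

End OrthogonalComplement.

(** * The dimension count and its generating function *)

(** The number of pairs [(a, e)] in [nat ^ b * {0, 1}] with [|a| + 2 e <= m],
    and also of those in [nat ^ b.+1 * {0, 1}] with [|a| + 2 e = m]: the first
    reading gives [dim V_m] for [b = 2 n], the second [dim W_m] for
    [b = 2 n - 1]. *)
Definition pair_count (b m : nat) : nat :=
  ('C(m + b, b) + (if (2 <= m)%N then 'C(m - 2 + b, b) else 0))%N.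

Lemma binz_sub2 (m b : nat) :
  binz (m%:Z + b%:Z - 2) b = (if (2 <= m)%N then 'C(m - 2 + b, b) else 0)%N.
Proof.
have [m2|m2] := leqP 2 m.
  have -> : m%:Z + b%:Z - 2 = (m - 2 + b)%N :> int.
    by rewrite PoszD -subzn // addrAC.
  by [].
have [mb|mb] := leqP 2 (m + b).
  have -> : m%:Z + b%:Z - 2 = (m + b - 2)%N :> int by rewrite -subzn.
  by rewrite /= bin_small //; lia.
by case: m b mb m2 => [|[|m]] [|[|b]].
Qed.

Lemma pair_count0 b : pair_count b 0 = 1%N.
Proof. by rewrite /pair_count add0n binn. Qed.

(** Pascal's rule; it computes [dim V_m - dim V_(m-1)]. *)
Lemma pair_countS b m :
  pair_count b.+1 m.+1 = (pair_count b.+1 m + pair_count b m.+1)%N.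
Proof.
have CS k : 'C(k.+1 + b.+1, b.+1) = ('C(k + b.+1, b.+1) + 'C(k.+1 + b, b))%N.
  by rewrite addSn binS addSnnS.
rewrite /pair_count CS; case: m => [|[|m]]; rewrite ?addn0 //.
  by rewrite !add0n !binn; lia.
by rewrite !subSS !subn0 /= !CS; lia.
Qed.

Lemma fps_coefMq (R : comUnitRingType) (f : fps R) m :
  fps_coef (f * 'q) m = if m is k.+1 then fps_coef f k else 0.
Proof.
rewrite fps_coefM; case: m => [|m]; first by rewrite big_ord1 mulr0.
rewrite !big_ord_recr /= subnn subSn // subnn mulr0 addr0 mulr1 big1 ?add0r //.
move=> i _; rewrite gtn_eqF ?mulr0 //.
by have := ltn_ord i; lia.
Qed.

(** By induction on [b]: multiplication by [1 - q] takes differences of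
    consecutive coefficients, and Pascal's rule lowers [b]. *)
Lemma fps_binomial (R : comUnitRingType) b :
  Fps (fun m => 'C(m + b, b)%:R : R) * (1 - 'q) ^+ b.+1 = 1.
Proof.
elim: b => [|b IH].
  apply: fpsP => m; rewrite expr1 mulrBr mulr1 fps_coefD fps_coefN fps_coefMq.
  by case: m => [|m]; rewrite ?subr0 //= !bin0 subrr.
rewrite exprS mulrA -[RHS]IH; congr (_ * _); apply: fpsP => m.
rewrite mulrBr mulr1 fps_coefD fps_coefN fps_coefMq /=.
case: m => [|m]; first by rewrite subr0 !binn.
by rewrite addSn binS natrD addrAC subrr add0r addSnnS.
Qed.

Lemma fps_pair_count b :
  Fps (fun m => (pair_count b m)%:Z) = (1 + 'q ^+ 2) / (1 - 'q) ^+ b.+1.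
Proof.
pose h : fps int := Fps (fun m => 'C(m + b, b)%:R).
have hU : h * (1 - 'q) ^+ b.+1 = 1 := fps_binomial int b.
have U : (1 - 'q : fps int) ^+ b.+1 \is a GRing.unit.
  by apply/unitrP; exists h; split; rewrite // mulrC.
apply: (mulIr U); rewrite divrK //.
transitivity (h * (1 + 'q ^+ 2) * (1 - 'q) ^+ b.+1); last first.
  by rewrite mulrAC hU mul1r.
congr (_ * _).
apply: fpsP => m; rewrite mulrDr mulr1 expr2 mulrA fps_coefD fps_coefMq.
rewrite /pair_count; case: m => [|[|m]];
  rewrite ?fps_coefMq /= natz ?addn0 ?addr0 //.
by rewrite natz !subSS subn0.
Qed.

Local Open Scope complex_scope.

(** * Polynomials vanishing near the origin *)

Lemma poly_inf_roots_eq0 (F : idomainType) (p : {poly F}) (r : nat -> F) :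
  injective r -> (forall i, root p (r i)) -> p = 0.
Proof.
move=> ri rp; apply: (@roots_geq_poly_eq0 _ _ (mkseq r (size p))).
- by apply/allP => _ /mapP[i _ ->].
- by rewrite mkseq_uniq.
- by rewrite size_mkseq.
Qed.

(** Uniqueness of base [N] expansions. *)
Lemma digits_inj k N : injective (fun t : k.-tuple 'I_N =>
  \sum_(i < k) tnth t i * N ^ i)%N.
Proof.
elim: k => [t u _|k IH t u]; first by rewrite [t]tuple0 [u]tuple0.
have digitsS (v : k.+1.-tuple 'I_N) : (\sum_(i < k.+1) tnth v i * N ^ i =
    thead v + N * \sum_(i < k) tnth (behead_tuple v) i * N ^ i)%N.
  rewrite big_ord_recl expn0 muln1; congr (_ + _)%N.
  rewrite big_distrr; apply: eq_bigr => i _.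
  rewrite tnth_behead expnS mulnCA.
  have -> : lift ord0 i = inord i.+1.
    by apply: val_inj; rewrite /= inordK // ltnS ltn_ord.
  by [].
have N0 : (0 < N)%N by apply: leq_ltn_trans (ltn_ord (thead t)).
rewrite !digitsS => E.
have hE : thead t = thead u.
  apply: val_inj => /=; move/(congr1 (modn^~ N)): E.
  by rewrite ![(_ + N * _)%N]addnC ![(N * _)%N]mulnC !modnMDl !modn_small.
move: E; rewrite hE => /addnI/eqP; rewrite eqn_pmul2l // => /eqP/IH tE.
rewrite (tuple_eta t) (tuple_eta u) hE; apply: val_inj => /=.
by congr (_ :: _); exact: (congr1 val tE).
Qed.

Section Monomials.
Context {R : realType}.

(** Kronecker substitution: at [z_i = y ^ (N ^ i)] the monomials of degree less
    than [N] in each variable become distinct powers of [y], and such points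
    lie in the unit ball for infinitely many [y]. *)
Lemma mpoly_ball_eq0 k N (P : pred (k.-tuple 'I_N))
    (c : {t : k.-tuple 'I_N | P t} -> R[i]) :
  (forall z : k.-tuple R, \sum_(i < k) tnth z i ^+ 2 < 1 ->
    \sum_t c t * (\prod_(i < k) tnth z i ^+ tnth (val t) i)%:C = 0) ->
  forall t, c t = 0.
Proof.
move=> c0 t0.
pose code (t : {t : k.-tuple 'I_N | P t}) :=
  (\sum_(i < k) tnth (val t) i * N ^ i)%N.
pose p : {poly R[i]} := \sum_t c t *: 'X^(code t).
suff p0 : p = 0.
  have := coef0 R[i] (code t0); rewrite -p0 coef_sum (bigD1 t0) //= coefZ coefXn.
  rewrite eqxx mulr1 big1 ?addr0 // => t tt0; rewrite coefZ coefXn.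
  case: eqP => [/digits_inj /val_inj tE|_]; last by rewrite mulr0.
  by rewrite tE eqxx in tt0.
(* [y <= 1 / (k + 1)] keeps the sum of the [k] squares [z_i ^ 2 <= y] below 1. *)
pose y (j : nat) : R := (k + j).+1%:R^-1.
apply: (@poly_inf_roots_eq0 _ _ (fun j => (y j)%:C)) => [i j|j].
  by move=> /complexI/invr_inj/eqP; rewrite eqr_nat eqSS eqn_add2l => /eqP.
have y0 : 0 <= y j by rewrite invr_ge0.
have y1 : y j <= 1 by rewrite invf_le1 ?ltr0n // ler1n.
pose z := [tuple y j ^+ (N ^ i) | i < k].
have /c0 : \sum_(i < k) tnth z i ^+ 2 < 1.
  have zy i : tnth z i ^+ 2 <= y j.
    have N0 : (0 < N)%N by apply: leq_ltn_trans (ltn_ord (tnth (val t0) i)).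
    rewrite tnth_mktuple -exprM -[leRHS]expr1 ler_wiXn2l // muln_gt0 expn_gt0.
    by rewrite N0.
  apply: le_lt_trans (ler_sum _ (fun i _ => zy i)) _.
  rewrite sumr_const card_ord -mulr_natl ltr_pdivrMr ?ltr0n // mul1r ltr_nat.
  by rewrite ltnS leq_addr.
move=> c0z; apply/eqP; rewrite -[RHS]c0z /p horner_sum; apply: eq_bigr => t _.
rewrite hornerZ hornerXn -rmorphXn; congr (_ * _%:C).
rewrite -prodrXr; apply: eq_bigr => i _.
by rewrite tnth_mktuple -exprM mulnC.
Qed.

End Monomials.

(** * Monomials on the Heisenberg group *)

Section HeisenbergMonomials.
Context {R : realType} {n : nat}.
Local Notation k := (2 * n)%N.
Implicit Types (a : 'I_k -> nat) (e j m : nat) (x : heis R n).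

Definition mon a e x : R := (\prod_(i < k) tnth x.1 i ^+ a i) * x.2 ^+ e.

Definition wdeg a e : nat := (\sum_(i < k) a i + 2 * e)%N.

Lemma mon_dilation a e r x : mon a e (dilation r x) = r ^+ wdeg a e * mon a e x.
Proof.
rewrite /mon /wdeg /= exprMn -exprM exprD mulrACA; congr (_ * _).
rewrite -prodrXr -big_split; apply: eq_bigr => i _ /=.
by rewrite tnth_map exprMn.
Qed.

Definition mpoly_mon a e : mpoly k.+1 R[i] :=
  (\prod_(i < k) mpolyX _ (mnm1 (widen_ord (leqnSn k) i)) ^+ a i)
  * mpolyX _ (mnm1 ord_max) ^+ e.

Let coordE x (i : 'I_k) : tnth [the k.+1.-tuple R of rcons x.1 x.2]
    (widen_ord (leqnSn k) i) = tnth x.1 i.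
Proof.
by rewrite !(tnth_nth 0) /= nth_rcons size_tuple ltn_ord.
Qed.

Let coord_max x : tnth [the k.+1.-tuple R of rcons x.1 x.2] ord_max = x.2.
Proof. by rewrite (tnth_nth 0) /= nth_rcons size_tuple ltnn eqxx. Qed.

Lemma peval_mon a e x : peval (mpoly_mon a e) x = (mon a e x)%:C.
Proof.
rewrite /peval /mpoly_mon mevalM rmorph_prod /= rmorphXn /= mevalXU coord_max.
rewrite /mon rmorphM rmorphXn rmorph_prod; congr (_ * _).
by apply: eq_bigr => i _; rewrite rmorphXn /= mevalXU coordE -rmorphXn.
Qed.

Let expz (mu : multinom k.+1) : 'I_k -> nat :=
  fun i => mu (widen_ord (leqnSn k) i).

Let pevalE (p : mpoly k.+1 R[i]) x : peval p x =
  \sum_(mu <- msupp p) mcoeff mu p * (mon (expz mu) (mu ord_max) x)%:C.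
Proof.
rewrite /peval mevalE; apply: eq_bigr => mu _; congr (_ * _).
rewrite big_ord_recr /= coord_max /mon rmorphM rmorph_prod rmorphXn.
by congr (_ * _); apply: eq_bigr => i _; rewrite coordE rmorphXn.
Qed.

(** Both sides of the homogeneity identity are polynomials in the dilation
    parameter, so that the coefficients of degree [j] agree. *)
Lemma homog_peval j (p : mpoly k.+1 R[i]) : homog j p -> forall x,
  peval p x = \sum_(mu <- msupp p | wdeg (expz mu) (mu ord_max) == j)
    mcoeff mu p * (mon (expz mu) (mu ord_max) x)%:C.
Proof.
move=> hp x; pose c mu := mcoeff mu p * (mon (expz mu) (mu ord_max) x)%:C.
pose q : {poly R[i]} := \sum_(mu <- msupp p)
  c mu *: 'X^(wdeg (expz mu) (mu ord_max)) - peval p x *: 'X^j.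
have q0 : q = 0.
  apply: (@poly_inf_roots_eq0 _ _ (fun i => i.+1%:R%:C)) => [i1 i2|i].
    by move=> /complexI/eqP; rewrite eqr_nat eqSS => /eqP.
  apply/rootP; rewrite /q hornerD hornerN hornerZ hornerXn horner_sum.
  rewrite mulrC -rmorphXn -hp ?ltr0n // pevalE; apply/eqP; rewrite subr_eq0.
  apply/eqP; apply: eq_bigr => mu _.
  rewrite hornerZ hornerXn mon_dilation rmorphM rmorphXn /c -mulrA.
  by congr (_ * _); rewrite mulrC.
have := coef0 R[i] j; rewrite -q0 coefB coef_sum coefZ coefXn eqxx mulr1.
move=> /eqP; rewrite subr_eq0 => /eqP <-; rewrite [RHS]big_mkcond.
apply: eq_bigr => mu _; rewrite coefZ coefXn eq_sym.
by case: eqP; rewrite ?mulr1 ?mulr0.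
Qed.

Lemma homog_lin j (I : Type) (r : seq I) (P : pred I) (F : I -> mpoly k.+1 R[i]) :
  (forall i, P i -> homog j (F i)) -> homog j (\sum_(i <- r | P i) F i).
Proof.
move=> hF s s0 x; rewrite /peval !raddf_sum mulr_sumr /=.
by apply: eq_bigr => i Pi; exact: hF.
Qed.

Lemma homog_mon (c : R[i]) a e j : wdeg a e = j -> homog j (c *: mpoly_mon a e).
Proof.
move=> <- s s0 x; rewrite /peval !mevalZ -/(peval _ _) -/(peval _ x) !peval_mon.
by rewrite mon_dilation rmorphM mulrCA.
Qed.

(** * Monomials restricted to the sphere *)

Lemma enorm4 (z : k.-tuple R) : enorm z ^+ 4 = (\sum_(i < k) tnth z i ^+ 2) ^+ 2.
Proof.
by rewrite /enorm (exprM _ 2 2) sqr_sqrtr // sumr_ge0 // => i _; rewrite sqr_ge0.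
Qed.

Lemma rho4_ge0 x : 0 <= enorm x.1 ^+ 4 + x.2 ^+ 2.
Proof. by rewrite enorm4 addr_ge0 // sqr_ge0. Qed.

Lemma rho_eq1 x : (rho x == 1) =
  ((\sum_(i < k) tnth x.1 i ^+ 2) ^+ 2 + x.2 ^+ 2 == 1).
Proof.
rewrite /rho -enorm4; apply/eqP/eqP => [E|->]; last by rewrite powR1.
set X := _ + _ in E *; have <- : (X `^ 4^-1) `^ 4 = X.
  by rewrite -powRrM mulVf ?pnatr_eq0 // powRr1 // rho4_ge0.
by rewrite E powR1.
Qed.

Definition smon a e : Srho R n -> R[i]^o := fun w => (mon a e (srho_val w))%:C.

Lemma srhoP (w : Srho R n) :
  (\sum_(i < k) tnth (srho_val w).1 i ^+ 2) ^+ 2 + (srho_val w).2 ^+ 2 = 1.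
Proof. by apply/eqP; rewrite -rho_eq1; case: w. Qed.

Lemma prod_pow_delta (z : k.-tuple R) i d :
  \prod_(l < k) tnth z l ^+ (d * (l == i)) = tnth z i ^+ d.
Proof.
rewrite (bigD1 i) //= eqxx muln1 big1 ?mulr1 // => l /negPf ->.
by rewrite muln0.
Qed.

Definition add_quartic a (p : 'I_k * 'I_k) : 'I_k -> nat :=
  fun i => (a i + (2 * (i == p.1) + 2 * (i == p.2)))%N.

Lemma mon_add_quartic a p e x :
  mon (add_quartic a p) e x = mon a e x * (tnth x.1 p.1 ^+ 2 * tnth x.1 p.2 ^+ 2).
Proof.
rewrite /mon mulrAC -(prod_pow_delta _ p.1) -(prod_pow_delta _ p.2) -!big_split.
by congr (_ * _); apply: eq_bigr => i _; rewrite /= !exprD.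
Qed.

Lemma wdeg_add_quartic a p e : wdeg (add_quartic a p) e = wdeg a e.+2.
Proof.
have sum1 i : (\sum_(l < k) 2 * (l == i) = 2)%N.
  by rewrite (bigD1 i) //= eqxx big1 // => l /negPf ->.
by rewrite /wdeg /add_quartic big_split [X in (_ + X + _)%N]big_split /= !sum1; lia.
Qed.

(** The relation [t ^ 2 = 1 - |z| ^ 4], expanded into monomials. *)
Lemma smon_rec a e :
  smon a e.+2 = smon a e - \sum_(p : 'I_k * 'I_k) smon (add_quartic a p) e.
Proof.
apply/funext => w.
have -> : (smon a e - \sum_p smon (add_quartic a p) e) w =
    smon a e w - \sum_p smon (add_quartic a p) e w.
  by rewrite !fctE fct_sumE.
rewrite /smon -rmorph_sum -rmorphB; congr (_%:C).
set x := srho_val w; under eq_bigr do rewrite mon_add_quartic.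
rewrite -mulr_sumr -(pair_bigA _ (fun i j : 'I_k =>
  tnth x.1 i ^+ 2 * tnth x.1 j ^+ 2)) /=.
under eq_bigr do rewrite -mulr_sumr.
rewrite -mulr_suml -expr2 -{1}[mon a e x]mulr1 -mulrBr -(srhoP w) addrC addKr.
by rewrite /mon -mulrA -exprD addn2.
Qed.

(** Exponents of the monomials that form a basis of [V_m]: the left summand
    holds those of [z ^ a], the right one those of [z ^ a t], which exist only
    when [2 <= m]. *)
Definition mon_index m : finType :=
  ({t : k.-tuple 'I_m.+1 | (\sum_(i <- t) i <= m)%N} +
   {t : k.-tuple 'I_(m - 2).+1 |
      (2 <= m)%N && (\sum_(i <- t) i <= m - 2)%N})%type.

Lemma card_mon_index m : #|mon_index m| = pair_count k m.
Proof.
rewrite /mon_index card_sum !card_sig /pair_count; congr (_ + _)%N.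
  by rewrite addnC -card_partial_ord_partitions cardsE.
case: ifP => _; last by rewrite eq_card0.
by rewrite addnC -card_partial_ord_partitions cardsE.
Qed.

Definition mon_exp m (I : mon_index m) : 'I_k -> nat :=
  match I with
  | inl t => fun i => tnth (val t) i
  | inr t => fun i => tnth (val t) i
  end.

Definition mon_eps m (I : mon_index m) : nat := if I is inl _ then 0%N else 1%N.

Lemma wdeg_exp m (I : mon_index m) : (wdeg (mon_exp I) (mon_eps I) <= m)%N.
Proof.
case: I => [] [t /= tm].
  rewrite /wdeg /= muln0 addn0.
  by rewrite -(big_tuple _ _ t xpredT (fun i : 'I_m.+1 => i : nat)).
case/andP: tm => m2 tm.
rewrite /wdeg /= -(big_tuple _ _ t xpredT (fun i : 'I_(m - 2).+1 => i : nat)).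
by apply: leq_trans (leq_add tm (leqnn _)) _; rewrite subnK.
Qed.

Definition smon_span m (f : Srho R n -> R[i]^o) : Prop :=
  exists c : mon_index m -> R[i],
    f = \sum_I c I *: smon (mon_exp I) (mon_eps I).

Lemma smon_span0 m : smon_span m 0.
Proof. by exists (fun=> 0); rewrite big1 // => I _; rewrite scale0r. Qed.

Lemma smon_spanD m (b : R[i]) f g : smon_span m f -> smon_span m g ->
  smon_span m (b *: f + g).
Proof.
move=> [c ->] [c' ->]; exists (fun I => b * c I + c' I).
rewrite scaler_sumr -big_split; apply: eq_bigr => I _.
by rewrite scalerDl scalerA.
Qed.

Lemma smon_span_sum m (I : Type) (r : seq I) (P : pred I) c F :
  (forall i, P i -> smon_span m (F i)) ->
  smon_span m (\sum_(i <- r | P i) c i *: F i).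
Proof.
move=> mF; elim: r => [|i r IH]; first by rewrite big_nil; exact: smon_span0.
by rewrite big_cons; case: ifP => // Pi; apply: smon_spanD => //; exact: mF.
Qed.

Lemma smon_span_index m (I : mon_index m) :
  smon_span m (smon (mon_exp I) (mon_eps I)).
Proof.
exists (fun J => (J == I)%:R); rewrite (bigD1 I) //= eqxx scale1r big1 ?addr0 //.
by move=> J /negPf ->; rewrite scale0r.
Qed.

(** The relation [smon_rec] preserves the degree bound and lowers the exponent
    of [t] by 2. *)
Lemma smon_span_mon m a e : (wdeg a e <= m)%N -> smon_span m (smon a e).
Proof.
have smon_ext b b' d : b =1 b' -> smon b d = smon b' d.
  by move=> /funext ->.
have [N] := ubnP e; elim: N a e => // N IH a [|[|e]] eN ae.
- have am i : (a i < m.+1)%N.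
    rewrite ltnS; apply: leq_trans ae.
    by rewrite /wdeg (bigD1 i) //= -addnA leq_addr.
  pose t := [tuple (inord (a i) : 'I_m.+1) | i < k].
  have tE i : tnth t i = a i :> nat by rewrite tnth_mktuple inordK.
  have tm : (\sum_(i <- t) i <= m)%N.
    rewrite big_tuple; under eq_bigr do rewrite tE.
    by move: ae; rewrite /wdeg muln0 addn0.
  rewrite -(smon_ext _ _ _ tE).
  exact: (@smon_span_index m (inl (exist _ t tm))).
- have m2 : (2 <= m)%N by move: ae; rewrite /wdeg; lia.
  have am i : (a i < (m - 2).+1)%N.
    have : (a i <= \sum_(j < k) a j)%N by rewrite (bigD1 i) //= leq_addr.
    by move: ae; rewrite /wdeg; lia.
  pose t := [tuple (inord (a i) : 'I_(m - 2).+1) | i < k].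
  have tE i : tnth t i = a i :> nat by rewrite tnth_mktuple inordK.
  have tm : (2 <= m)%N && (\sum_(i <- t) i <= m - 2)%N.
    rewrite m2 big_tuple; under eq_bigr do rewrite tE.
    by move: ae; rewrite /wdeg /=; lia.
  rewrite -(smon_ext _ _ _ tE).
  exact: (@smon_span_index m (inr (exist _ t tm))).
- rewrite smon_rec addrC -scaleN1r; apply: smon_spanD.
    under eq_bigr do rewrite -[smon _ _]scale1r.
    apply: (@smon_span_sum _ _ _ _ (fun=> 1)) => p _.
    by apply: IH; [lia|rewrite wdeg_add_quartic].
  by apply: IH; [lia|apply: leq_trans ae; rewrite /wdeg; lia].
Qed.

Lemma restr_sum (I : Type) (r : seq I) (P : pred I) (F : I -> mpoly k.+1 R[i]) :
  restr (\sum_(i <- r | P i) F i) = \sum_(i <- r | P i) restr (F i).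
Proof.
by apply/funext => w; rewrite fct_sumE /restr /peval raddf_sum.
Qed.

(** By [homog_peval] a component of degree [j] takes the values of its monomials
    of weighted degree [j], which [smon_span_mon] reduces on the sphere. *)
Lemma spaceV_span m f : spaceV R n (Posz m) f <-> smon_span m f.
Proof.
split=> [[_ [p hp <-] <-]|[c ->]].
  rewrite restr_sum; under eq_bigr do rewrite -[restr _]scale1r.
  apply: (@smon_span_sum _ _ _ _ (fun=> 1)) => j _.
  have -> : restr (p j) = \sum_(mu <- msupp (p j) |
      wdeg (expz mu) (mu ord_max) == j)
      mcoeff mu (p j) *: smon (expz mu) (mu ord_max).
    by apply/funext => w; rewrite /restr (homog_peval (hp j)) fct_sumE.
  apply: smon_span_sum => mu /eqP muj; apply: smon_span_mon.
  by rewrite muj -ltnS.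
pose p j := \sum_(I : mon_index m | wdeg (mon_exp I) (mon_eps I) == j)
  c I *: mpoly_mon (mon_exp I) (mon_eps I).
exists (\sum_(j < m.+1) p j).
  exists p => // j; apply: homog_lin => I /eqP; exact: homog_mon.
rewrite restr_sum; under eq_bigr do rewrite restr_sum.
rewrite [RHS](partition_big
  (fun I => inord (wdeg (mon_exp I) (mon_eps I)) : 'I_m.+1) predT) //=.
apply: eq_bigr => j _; apply: eq_big => I.
  by rewrite -val_eqE /= inordK // ltnS wdeg_exp.
move=> _; apply/funext => w; rewrite /restr /peval mevalZ.
by rewrite -/(peval _ _) peval_mon.
Qed.

(** Replacing [t] by [- t] separates the two halves of the index set, and
    every [z] in the open unit ball occurs on the sphere with [t != 0]. *)
Lemma smon_free m (c : mon_index m -> R[i]) :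
  \sum_I c I *: smon (mon_exp I) (mon_eps I) = 0 -> forall I, c I = 0.
Proof.
move=> c0.
pose mz (z : k.-tuple R) N (t : k.-tuple 'I_N) :=
  (\prod_(i < k) tnth z i ^+ tnth t i)%:C.
pose u z := \sum_t c (inl t) * mz z _ (val t).
pose v z := \sum_t c (inr t) * mz z _ (val t).
have uv z : \sum_(i < k) tnth z i ^+ 2 < 1 -> u z = 0 /\ v z = 0.
  set q := \sum_(i < k) _ => q1.
  have q0 : 0 <= q by apply: sumr_ge0 => i _; rewrite sqr_ge0.
  have q2 : 0 < 1 - q ^+ 2 by rewrite subr_gt0 expr_lt1.
  pose s := Num.sqrt (1 - q ^+ 2).
  have s2 : s ^+ 2 = 1 - q ^+ 2 by rewrite sqr_sqrtr // ltW.
  have E r : r ^+ 2 = 1 - q ^+ 2 -> u z + r%:C * v z = 0.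
    move=> r2.
    have zr : rho ((z, r) : heis R n) == 1 by rewrite rho_eq1 /= r2 addrC subrK.
    pose w : Srho R n := exist (fun x : heis R n => rho x == 1) (z, r) zr.
    transitivity ((\sum_I c I *: smon (mon_exp I) (mon_eps I)) w); last by rewrite c0.
    rewrite fct_sumE big_sumType /=.
    congr (_ + _); rewrite /u /v ?mulr_sumr; apply: eq_bigr => t _.
      rewrite -[RHS]/(c (inl t) * (mon (fun i => tnth (val t) i) 0 (z, r))%:C).
      by rewrite /mon expr0 mulr1.
    rewrite -[RHS]/(c (inr t) * (mon (fun i => tnth (val t) i) 1 (z, r))%:C).
    by rewrite /mon expr1 rmorphM mulrCA; congr (_ * _); rewrite mulrC.
  have Ep := E s s2; have En : u z - s%:C * v z = 0.
    by rewrite -mulNr -rmorphN E // sqrrN.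
  have u0 : u z = 0.
    have : u z *+ 2 = 0.
      transitivity ((u z + s%:C * v z) + (u z - s%:C * v z)).
        by rewrite addrACA subrr addr0.
      by rewrite Ep En addr0.
    by move/eqP; rewrite mulrn_eq0 /= => /eqP.
  split=> //; move: Ep; rewrite u0 add0r => /eqP; rewrite mulf_eq0 => /orP[|/eqP //].
  by rewrite fmorph_eq0 gt_eqF // sqrtr_gt0.
case=> t; first by apply: (mpoly_ball_eq0 (c := fun t => c (inl t))) => z /uv[].
by apply: (mpoly_ball_eq0 (c := fun t => c (inr t))) => z /uv[].
Qed.

Lemma has_dim_spaceV m : has_dim (spaceV R n (Posz m)) (pair_count k m).
Proof.
rewrite -card_mon_index.
by apply: has_dim_fin; [exact: smon_free|exact: spaceV_span].
Qed.

End HeisenbergMonomials.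

(** * Lebesgue measure charges every open set *)

Section Box.
Context {R : realType}.

Lemma lebesgue_ball_gt0 (t d : R) : 0 < d -> (0 < lebesgue_measure (ball t d))%E.
Proof.
by move=> d0; rewrite lebesgue_measure_ball ?lte_fin ?mulrn_wgt0 // ltW.
Qed.

Definition box k (z : k.-tuple R) (d : R) : set (k.-tuple R) :=
  [set y | forall i, ball (tnth z i) d (tnth y i)].

Lemma measurable_box k (z : k.-tuple R) d : measurable (box z d).
Proof.
have -> : box z d =
    \bigcap_(i in [set: 'I_k]) ((@tnth _ R ^~ i) @^-1` ball (tnth z i) d).
  by apply/seteqP; split => y /= H i => [_|]; exact: H.
apply: fin_bigcap_measurable; first exact: finite_finset.
move=> i _; rewrite -[X in measurable X]setTI.
by apply: measurable_tnth => //; exact: measurable_ball.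
Qed.

Lemma tuple_lebesgue_box_gt0 k (z : k.-tuple R) d : 0 < d ->
  (0 < tuple_lebesgue R k (box z d))%E.
Proof.
move=> d0; elim: k z => [|k IH] z.
  by rewrite /= diracE (_ : _ \in _) ?lte_fin // inE => -[].
rewrite /= /pushforward.
have -> : @tcons R k @^-1` box z d = box (behead_tuple z) d `*` ball (thead z) d.
  apply/seteqP; split => -[y t] /= H.
    split => [i|]; last by have := H ord0; rewrite !tnth0.
    have := H (lift ord0 i); rewrite (tnth_behead z) tnthS.
    rewrite (_ : inord i.+1 = lift ord0 i) //; apply: val_inj.
    by rewrite /= inordK // ltnS ltn_ord.
  case: H => Hy Ht i; case: (unliftP ord0 i) => [j|] ->; last by rewrite tnth0.
  have := Hy j; rewrite (tnth_behead z) tnthS.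
  rewrite (_ : inord j.+1 = lift ord0 j) //; apply: val_inj.
  by rewrite /= inordK // ltnS ltn_ord.
rewrite product_measure1E; last 2 first.
- exact: measurable_box.
- exact: measurable_ball.
by apply: mule_gt0; [exact: IH|exact: lebesgue_ball_gt0].
Qed.

Lemma heis_lebesgue_box_gt0 n (x : heis R n) d : 0 < d ->
  (0 < @heis_lebesgue R n (box x.1 d `*` ball x.2 d))%E.
Proof.
move=> d0; rewrite /heis_lebesgue product_measure1E; last 2 first.
- exact: measurable_box.
- exact: measurable_ball.
by apply: mule_gt0; [exact: tuple_lebesgue_box_gt0|exact: lebesgue_ball_gt0].
Qed.

(** Continuity of a function on [heis R n] is that of its composite with these
    coordinates, for which balls of the source are products of boxes. *)
Definition heis_of_row n (v : 'rV[R]_(2 * n) * R) : heis R n :=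
  ([tuple v.1 0 i | i < 2 * n], v.2).

(** If [G x0 > 0], then [G] exceeds [G x0 / 2] on a box around [x0], which has
    positive measure. *)
Lemma nonneg_integral_eq0 n (G : heis R n -> R) :
  measurable_fun [set: heis R n] G -> continuous (G \o @heis_of_row n) ->
  (forall x, 0 <= G x) -> (\int[@heis_lebesgue R n]_x (G x)%:E = 0)%E ->
  forall x, G x = 0.
Proof.
move=> mG cG G0 IG x0; apply/eqP; rewrite eq_le G0 andbT leNgt; apply/negP => Gx0.
pose v0 : 'rV[R]_(2 * n) * R := (\row_i tnth x0.1 i, x0.2).
have v0E : heis_of_row v0 = x0.
  rewrite [RHS]surjective_pairing; congr pair.
  by apply: eq_from_tnth => i; rewrite tnth_mktuple mxE.
pose c := G x0 / 2; have c0 : 0 < c by rewrite divr_gt0.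
have : \forall v \near v0, c < (G \o @heis_of_row n) v.
  apply: (cvgr_gt _ (cG v0)); rewrite /= v0E /c ltr_pdivrMr //.
  by rewrite mulr_natr mulr2n ltrDl.
move=> /nbhs_ballP[d /= d0 dG].
pose B := box x0.1 d `*` ball x0.2 d.
have mB : measurable B.
  by apply: measurableX; [exact: measurable_box|exact: measurable_ball].
have BG x : B x -> c <= G x.
  move=> [xz xt]; pose v : 'rV[R]_(2 * n) * R := (\row_i tnth x.1 i, x.2).
  have vE : heis_of_row v = x.
    rewrite [RHS]surjective_pairing; congr pair.
    by apply: eq_from_tnth => i; rewrite tnth_mktuple mxE.
  rewrite -vE; apply/ltW/dG; split => //=; split=> // i j; rewrite !mxE; exact: xz.
have : (\int[@heis_lebesgue R n]_(x in B) (cst c%:E x) <= 0)%E.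
  rewrite -IG.
  apply: (@le_trans _ _ (\int[@heis_lebesgue R n]_(x in B) (G x)%:E)%E).
    apply: ge0_le_integral => //.
    - by move=> x _; rewrite lee_fin ltW.
    - by apply: measurable_funTS; apply/measurable_EFinP.
  apply: ge0_subset_integral => //.
  - exact/measurable_EFinP.
  - by move=> x _; rewrite lee_fin.
rewrite integral_cst // leNgt mule_gt0 ?lte_fin //.
exact: heis_lebesgue_box_gt0.
Qed.

End Box.

(** * Polynomials with zero integral of the square on the sphere *)

Section PolarMeasure.
Context {R : realType} {n : nat}.
Local Notation k := (2 * n)%N.
Implicit Types (a : 'I_k -> nat) (e m : nat) (x : heis R n).

Lemma rhoE x : rho x =
  ((\sum_(i < k) tnth x.1 i ^+ 2) ^+ 2 + x.2 ^+ 2) `^ 4^-1.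
Proof. by rewrite /rho enorm4. Qed.

Lemma rho_dilation (r : R) x : 0 <= r -> rho (dilation r x) = r * rho x.
Proof.
move=> r0; rewrite !rhoE /=.
under eq_bigr do rewrite tnth_map exprMn.
rewrite -mulr_sumr exprMn [X in _ + X]exprMn -!exprM -mulrDr powRM ?exprn_ge0 //;
  last first.
  by rewrite addr_ge0 // sqr_ge0.
congr (_ * _); rewrite -powR_mulrn // -powRrM mulfV ?pnatr_eq0 //.
exact: powRr1.
Qed.

Lemma measurable_coord i : measurable_fun [set: heis R n] (fun x => tnth x.1 i).
Proof.
exact: (measurableT_comp (measurable_tnth i) measurable_fst).
Qed.

Lemma measurable_mon a e : measurable_fun [set: heis R n] (mon a e).
Proof.
apply: measurable_funM; last by apply: measurable_funX; exact: measurable_snd.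
by apply: measurable_prod => i _; apply: measurable_funX; exact: measurable_coord.
Qed.

Lemma measurable_rho : measurable_fun [set: heis R n] (@rho R n).
Proof.
rewrite (_ : @rho R n = fun x =>
    ((\sum_(i < k) tnth x.1 i ^+ 2) ^+ 2 + x.2 ^+ 2) `^ 4^-1); last first.
  by apply/funext => x; exact: rhoE.
apply: (measurableT_comp (measurable_powR _)).
apply: measurable_funD; apply: measurable_funX; last exact: measurable_snd.
by apply: measurable_sum => i; apply: measurable_funX; exact: measurable_coord.
Qed.

Lemma continuous_sum (T : topologicalType) (I : Type) (r : seq I) (F : I -> T -> R) :
  (forall i, continuous (F i)) -> continuous (fun y => \sum_(i <- r) F i y).
Proof.
move=> cF; elim: r => [|i r IH] y.
  by under eq_fun do rewrite big_nil; exact: cvg_cst.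
by under eq_fun do rewrite big_cons; apply: cvgD; [exact: cF|exact: IH].
Qed.

Lemma continuous_prod (T : topologicalType) (I : Type) (r : seq I) (F : I -> T -> R) :
  (forall i, continuous (F i)) -> continuous (fun y => \prod_(i <- r) F i y).
Proof.
move=> cF; elim: r => [|i r IH] y.
  by under eq_fun do rewrite big_nil; exact: cvg_cst.
by under eq_fun do rewrite big_cons; apply: cvgM; [exact: cF|exact: IH].
Qed.

Lemma continuousX (T : topologicalType) (f : T -> R) d :
  continuous f -> continuous (fun y => f y ^+ d).
Proof.
move=> cf; elim: d => [|d IH] y; first exact: cvg_cst.
by under eq_fun do rewrite exprS; apply: cvgM; [exact: cf|exact: IH].
Qed.

Let continuous_coord i :
  continuous ((fun x => tnth x.1 i) \o @heis_of_row R n).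
Proof.
rewrite (_ : _ \o _ = (fun M : 'rV[R]_k => M 0 i) \o fst).
  move=> v; apply: continuous_comp; [exact: cvg_fst|exact: coord_continuous].
by apply/funext => v; rewrite /= tnth_mktuple.
Qed.

Let continuous_snd : continuous (snd \o @heis_of_row R n).
Proof. by move=> v; exact: cvg_snd. Qed.

Lemma continuous_mon a e : continuous (mon a e \o @heis_of_row R n).
Proof.
move=> v; apply: cvgM.
  move: v; apply: continuous_prod => i; apply: continuousX; exact: continuous_coord.
by move: v; apply: continuousX; exact: continuous_snd.
Qed.

Lemma continuous_rho : continuous (@rho R n \o @heis_of_row R n).
Proof.
pose f x : R := (\sum_(i < k) tnth x.1 i ^+ 2) ^+ 2 + x.2 ^+ 2.
have -> : @rho R n \o @heis_of_row R n =
    Num.sqrt \o (Num.sqrt \o (f \o @heis_of_row R n)).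
  apply/funext => v /=; rewrite rhoE -/(f _).
  have f0 : 0 <= f (heis_of_row v) by rewrite addr_ge0 // sqr_ge0.
  rewrite -!powR12_sqrt ?sqrtr_ge0 ?powR_ge0 // -powRrM; congr (_ `^ _).
  by rewrite -invfM -natrM.
have cf : continuous (f \o @heis_of_row R n).
  move=> v; apply: cvgD; move: v.
    apply: continuousX; apply: continuous_sum => i; apply: continuousX.
    exact: continuous_coord.
  by apply: continuousX; exact: continuous_snd.
move=> v; apply: continuous_comp; last exact: sqrt_continuous.
by apply: continuous_comp; [exact: cf|exact: sqrt_continuous].
Qed.

Variables (sigma : {finite_measure set (Srho R n) -> \bar R}).
Hypothesis hsigma : is_polar_measure sigma.

Lemma measurable_mon_srho a e :
  measurable_fun [set: Srho R n] (mon a e \o @srho_val R n).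
Proof.
move=> _ Y mY; exists (mon a e @^-1` Y); last by rewrite !setTI.
by rewrite -[X in measurable X]setTI; exact: measurable_mon.
Qed.

(** Multiplying each monomial by a power of [rho] makes all of them homogeneous
    of degree [m] without changing them on the sphere.  The square of the
    resulting function has Lebesgue integral 0 by the polar formula; being
    continuous, it is zero. *)
Lemma polar_sqr_integral_eq0 m (c : mon_index m -> R) :
  let g x := \sum_I c I * mon (mon_exp I) (mon_eps I) x in
  (\int[sigma]_w (g (srho_val w) ^+ 2)%:E = 0)%E ->
  forall w : Srho R n, g (srho_val w) = 0.
Proof.
move=> g Ig w.
pose d (I : @mon_index n m) := wdeg (mon_exp I) (mon_eps I).
pose h x := \sum_I c I * (rho x ^+ (m - d I) * mon (mon_exp I) (mon_eps I) x).
have hE (s : R) (u : Srho R n) : 0 <= s ->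
    h (dilation s (srho_val u)) = s ^+ m * g (srho_val u).
  move=> s0; rewrite /h /g mulr_sumr; apply: eq_bigr => I _.
  have /eqP rho1 : rho (srho_val u) == 1 by case: u.
  rewrite rho_dilation // rho1 mulr1 mon_dilation [X in c I * X]mulrA.
  by rewrite -exprD subnK ?wdeg_exp // mulrCA.
have mh : measurable_fun [set: heis R n] (fun x => h x ^+ 2).
  apply: measurable_funX; apply: measurable_sum => I; apply: measurable_funM => //.
  apply: measurable_funM; last exact: measurable_mon.
  by apply: measurable_funX; exact: measurable_rho.
have ch : continuous ((fun x => h x ^+ 2) \o @heis_of_row R n).
  apply: continuousX; apply: continuous_sum => I v; apply: cvgM; first exact: cvg_cst.
  apply: cvgM; last exact: continuous_mon.
  by move: v; apply: continuousX; exact: continuous_rho.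
have mg : measurable_fun [set: Srho R n] (fun u => (g (srho_val u) ^+ 2)%:E).
  apply/measurable_EFinP; apply: measurable_funX; apply: measurable_sum => I.
  by apply: measurable_funM => //; exact: measurable_mon_srho.
have h0 : (\int[@heis_lebesgue R n]_x (h x ^+ 2)%:E = 0)%E.
  rewrite hsigma; last 2 first.
  - exact/measurable_EFinP.
  - by move=> x; rewrite lee_fin sqr_ge0.
  apply: integral0_eq => s /=; rewrite in_itv /= andbT => s0.
  under eq_integral => u _.
    rewrite hE ?(ltW s0) // -EFinM exprMn mulrAC EFinM.
    over.
  rewrite ge0_integralZl //.
  - by rewrite Ig mule0.
  - by move=> u _; rewrite lee_fin sqr_ge0.
  - by rewrite lee_fin mulr_ge0 // ?exprn_ge0 // ltW.
have /(_ (srho_val w))/eqP := nonneg_integral_eq0 mh ch (fun x => sqr_ge0 _) h0.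
rewrite sqrf_eq0 => /eqP.
have := hE 1 w ler01; rewrite expr1n mul1r => <-.
rewrite /dilation; case: (srho_val w) => z t /=; rewrite expr1n mul1r => hz.
have -> // : [tuple of [seq 1 * y | y <- z]] = z.
by apply: eq_from_tnth => i; rewrite tnth_map mul1r.
Qed.
End PolarMeasure.

(** * The inner product on restricted polynomials *)

Section InnerProduct.
Context {R : realType} {n : nat}.
Local Notation k := (2 * n)%N.
Variables (sigma : {finite_measure set (Srho R n) -> \bar R}).

Definition bounded_measurable (g : Srho R n -> R) : Prop :=
  measurable_fun [set: Srho R n] g /\ exists M, forall w, `|g w| <= M.

Lemma bounded_measurable_integrable g :
  bounded_measurable g -> sigma.-integrable [set: Srho R n] (EFin \o g).
Proof.
move=> [mg [M gM]]; apply: measurable_bounded_integrable => //.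
  exact: fin_num_fun_lty.
exists M; split; first exact: num_real.
by move=> x Mx w _ /=; apply: le_trans (gM w) (ltW Mx).
Qed.

Lemma bounded_measurable_cst (c : R) : bounded_measurable (fun=> c).
Proof. by split => //; exists `|c|. Qed.

Lemma bounded_measurableD f g : bounded_measurable f -> bounded_measurable g ->
  bounded_measurable (fun w => f w + g w).
Proof.
move=> [mf [M fM]] [mg [N gN]]; split; first exact: measurable_funD.
by exists (M + N) => w; apply: le_trans (ler_normD _ _) (lerD (fM w) (gN w)).
Qed.

Lemma bounded_measurableM f g : bounded_measurable f -> bounded_measurable g ->
  bounded_measurable (fun w => f w * g w).
Proof.
move=> [mf [M fM]] [mg [N gN]]; split; first exact: measurable_funM.
by exists (M * N) => w; rewrite normrM ler_pM.
Qed.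

Lemma bounded_measurableN f : bounded_measurable f ->
  bounded_measurable (fun w => - f w).
Proof.
by move=> [mf [M fM]]; split; [exact: measurableT_comp|exists M => w; rewrite normrN].
Qed.

Lemma bounded_measurable_mon a e : bounded_measurable (mon a e \o @srho_val R n).
Proof.
split; first exact: measurable_mon_srho.
exists 1 => w /=; have := srhoP w; set x := srho_val w; set q := \sum_(i < k) _ => qt.
have q1 : q <= 1.
  rewrite -(@expr_le1 _ 2) ?sumr_ge0 // -?qt ?lerDl ?sqr_ge0 // => i _.
  exact: sqr_ge0.
have abs1 (y : R) : y ^+ 2 <= 1 -> `|y| <= 1.
  by move=> y1; rewrite -(@expr_le1 _ 2) // real_normK ?num_real.
rewrite /mon normrM normr_prod mulr_ile1 ?prodr_ge0 //.
  apply: prodr_ile1 => i _; rewrite normrX exprn_ge0 //= exprn_ile1 //.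
  apply: abs1; apply: le_trans q1; rewrite /q (bigD1 i) //= lerDl.
  by rewrite sumr_ge0 // => j _; rewrite sqr_ge0.
by rewrite normrX exprn_ile1 // abs1 // -qt lerDr sqr_ge0.
Qed.

Definition cbounded_measurable (f : Srho R n -> R[i]) : Prop :=
  bounded_measurable (fun w => complex.Re (f w)) /\
  bounded_measurable (fun w => complex.Im (f w)).

Let ReD (z z' : R[i]) : complex.Re (z + z') = complex.Re z + complex.Re z'.
Proof. by case: z z' => ? ? []. Qed.
Let ImD (z z' : R[i]) : complex.Im (z + z') = complex.Im z + complex.Im z'.
Proof. by case: z z' => ? ? []. Qed.
Let ReM (z z' : R[i]) : complex.Re (z * z') =
  complex.Re z * complex.Re z' - complex.Im z * complex.Im z'.
Proof. by case: z z' => ? ? []. Qed.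
Let ImM (z z' : R[i]) : complex.Im (z * z') =
  complex.Re z * complex.Im z' + complex.Im z * complex.Re z'.
Proof. by case: z z' => ? ? []. Qed.

Lemma cbounded_measurableD f g :
  cbounded_measurable f -> cbounded_measurable g ->
  cbounded_measurable (fun w => f w + g w).
Proof.
move=> [fr fi] [gr gi]; split.
  by under eq_fun do rewrite ReD; exact: bounded_measurableD.
by under eq_fun do rewrite ImD; exact: bounded_measurableD.
Qed.

Lemma cbounded_measurableM f g :
  cbounded_measurable f -> cbounded_measurable g ->
  cbounded_measurable (fun w => f w * g w).
Proof.
move=> [fr fi] [gr gi]; split.
  under eq_fun do rewrite ReM.
  apply: bounded_measurableD; first exact: bounded_measurableM.
  by apply: bounded_measurableN; exact: bounded_measurableM.
under eq_fun do rewrite ImM.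
by apply: bounded_measurableD; exact: bounded_measurableM.
Qed.

Lemma cbounded_measurable_cst (c : R[i]) : cbounded_measurable (fun=> c).
Proof. by split; exact: bounded_measurable_cst. Qed.

Lemma cbounded_measurable_conj f : cbounded_measurable f ->
  cbounded_measurable (fun w => (f w)^*).
Proof.
move=> [fr fi]; split.
  rewrite (_ : (fun w => _) = fun w => complex.Re (f w)) //.
  by apply/funext => w; case: (f w).
rewrite (_ : (fun w => _) = fun w => - complex.Im (f w)).
  exact: bounded_measurableN.
by apply/funext => w; case: (f w).
Qed.

Lemma cbounded_measurable_spaceV m f :
  spaceV R n (Posz m) f -> cbounded_measurable f.
Proof.
move=> /spaceV_span[c ->]; elim: index_enum => [|I r IH].
  by rewrite big_nil; exact: cbounded_measurable_cst.
rewrite big_cons; apply: cbounded_measurableD => //.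
apply: cbounded_measurableM; first exact: cbounded_measurable_cst.
by split; [exact: bounded_measurable_mon|exact: bounded_measurable_cst].
Qed.

Lemma cintegral_lin (a : R[i]) f g :
  cbounded_measurable f -> cbounded_measurable g ->
  cintegral sigma (fun w => a * f w + g w) = a * cintegral sigma f + cintegral sigma g.
Proof.
move=> [fr fi] [gr gi].
have intD h h' : bounded_measurable h -> bounded_measurable h' ->
    (\int[sigma]_w (h w + h' w) = \int[sigma]_w h w + \int[sigma]_w h' w)%R.
  by move=> bh bh'; apply: RintegralD => //; exact: bounded_measurable_integrable.
have intZ b h : bounded_measurable h ->
    (\int[sigma]_w (b * h w) = b * \int[sigma]_w h w)%R.
  by move=> bh; apply: RintegralZl => //; exact: bounded_measurable_integrable.
have bZ b h : bounded_measurable h -> bounded_measurable (fun w => b * h w).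
  by apply: bounded_measurableM; exact: bounded_measurable_cst.
case: a => ar ai; rewrite /cintegral.
have -> : (fun w => complex.Re ((ar +i* ai) * f w + g w)) =
    (fun w => (ar * complex.Re (f w) + (- ai) * complex.Im (f w)) + complex.Re (g w)).
  by apply/funext => w; rewrite ReD ReM mulNr.
have -> : (fun w => complex.Im ((ar +i* ai) * f w + g w)) =
    (fun w => (ar * complex.Im (f w) + ai * complex.Re (f w)) + complex.Im (g w)).
  by apply/funext => w; rewrite ImD ImM.
rewrite !intD ?intZ //; do ?by [exact: bZ|apply: bounded_measurableD; exact: bZ].
by apply/eqP; rewrite eq_complex /= mulNr !eqxx.
Qed.

Lemma inner_linl (a : R[i]) f f' g : cbounded_measurable f ->
  cbounded_measurable f' -> cbounded_measurable g ->
  inner sigma (a *: f + f') g = a * inner sigma f g + inner sigma f' g.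
Proof.
move=> bf bf' bg; have bg' := cbounded_measurable_conj bg.
rewrite /inner -cintegral_lin; do ?exact: cbounded_measurableM.
by congr (cintegral _ _); apply/funext => w /=; rewrite mulrDl mulrA.
Qed.

Lemma inner_linr (a : R[i]) f g g' : cbounded_measurable f ->
  cbounded_measurable g -> cbounded_measurable g' ->
  inner sigma f (a *: g + g') = a^* * inner sigma f g + inner sigma f g'.
Proof.
move=> bf bg bg'; rewrite /inner -cintegral_lin; do ?
  by apply: cbounded_measurableM => //; exact: cbounded_measurable_conj.
congr (cintegral _ _); apply/funext => w /=.
by rewrite rmorphD rmorphM mulrDr mulrCA.
Qed.

Hypothesis hsigma : is_polar_measure sigma.

(** The norm of [f] is the sum of the integrals of the squares of its real and
    imaginary parts, which are real combinations of monomials. *)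
Lemma inner_definite m f : spaceV R n (Posz m) f -> inner sigma f f = 0 -> f = 0.
Proof.
move=> Vf /(congr1 (@complex.Re _)) /=.
have [bR bI] := cbounded_measurable_spaceV Vf.
have bsq (g : Srho R n -> R) : bounded_measurable g ->
    sigma.-integrable [set: Srho R n] (EFin \o (fun w => g w ^+ 2)).
  by move=> bg; apply: bounded_measurable_integrable; exact: bounded_measurableM.
have -> : (fun w => complex.Re (f w * (f w)^*)) =
    (fun w => complex.Re (f w) ^+ 2 + complex.Im (f w) ^+ 2).
  by apply/funext => w; case: (f w) => x y /=; rewrite mulrN opprK -!expr2.
rewrite RintegralD //; do ?exact: bsq.
move/eqP; rewrite paddr_eq0; do ?by apply: Rintegral_ge0 => w _; exact: sqr_ge0.
have int0 (g : Srho R n -> R) : bounded_measurable g ->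
    (\int[sigma]_w (g w ^+ 2))%R == 0 -> (\int[sigma]_w (g w ^+ 2)%:E = 0)%E.
  move=> bg /eqP g0; rewrite -[LHS]fineK.
    by congr EFin.
  by apply: integrable_fin_num => //; exact: bsq.
case/andP => /(int0 _ bR) R0 /(int0 _ bI) I0.
have [c fE] : smon_span m f by apply/spaceV_span.
have ReE w : complex.Re (f w) =
    \sum_I complex.Re (c I) * mon (mon_exp I) (mon_eps I) (srho_val w).
  rewrite fE fct_sumE.
  rewrite (big_morph _ ReD (erefl : complex.Re 0 = 0)).
  by apply: eq_bigr => I _; rewrite /= ReM mulr0 subr0.
have ImE w : complex.Im (f w) =
    \sum_I complex.Im (c I) * mon (mon_exp I) (mon_eps I) (srho_val w).
  rewrite fE fct_sumE (big_morph _ ImD (erefl : complex.Im 0 = 0)).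
  by apply: eq_bigr => I _; rewrite /= ImM mulr0 add0r.
apply/funext => w; apply/eqP; rewrite eq_complex /= ReE ImE; apply/andP; split.
  apply/eqP/(polar_sqr_integral_eq0 hsigma).
  by rewrite -[RHS]R0; apply: eq_integral => u _; rewrite ReE.
apply/eqP/(polar_sqr_integral_eq0 hsigma).
by rewrite -[RHS]I0; apply: eq_integral => u _; rewrite ImE.
Qed.

Lemma has_dim_spaceV_pred m : has_dim (spaceV R n (Posz m - 1))
  (if m is m'.+1 then pair_count k m' else 0%N).
Proof.
case: m => [|m]; last first.
  by rewrite -[m.+1]addn1 PoszD addrK; exact: has_dim_spaceV.
exists (fun=> 0); split => [c _ []//|]; apply/seteqP; split => f /=.
  move=> [_ -> <-]; exists (fun=> 0) => //; rewrite big_ord0.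
  by apply/funext => w; rewrite /restr /peval meval0.
move=> [c _ <-]; rewrite big_ord0; exists 0 => //.
by apply/funext => w; rewrite /restr /peval meval0.
Qed.

Lemma spaceV_pred_sub m : spaceV R n (Posz m - 1) `<=` spaceV R n (Posz m).
Proof.
move=> f Vf; apply/spaceV_span; case: m Vf => [|m].
  move=> [_ -> <-]; rewrite (_ : restr 0 = 0); first exact: smon_span0.
  by apply/funext => w; rewrite /restr /peval meval0.
rewrite -[X in Posz X - 1]addn1 PoszD addrK => /spaceV_span[c ->].
apply: smon_span_sum => I _; apply: smon_span_mon.
exact: leq_trans (wdeg_exp I) (leqnSn m).
Qed.

Lemma has_dim_spaceW m : (0 < n)%N ->
  has_dim (spaceW sigma (Posz m)) (pair_count (k - 1) m).
Proof.
move=> n0.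
have -> : pair_count (k - 1) m =
    (pair_count k m - if m is m'.+1 then pair_count k m' else 0)%N.
  have [b ->] : exists b, k = b.+1 by exists (k - 1)%N; lia.
  by rewrite subn1; case: m => [|m]; rewrite ?pair_count0 // pair_countS addKn.
have bm := @cbounded_measurable_spaceV m; have sub := @spaceV_pred_sub m.
apply: (has_dim_orthocompl (s := conjc) (has_dim_spaceV m) (has_dim_spaceV_pred m)) => //.
- by move=> a f f' g /bm bf /bm bf' /sub/bm bg; exact: inner_linl.
- by move=> a f g g' /bm bf /sub/bm bg /sub/bm bg'; exact: inner_linr.
- by move=> f /sub; exact: inner_definite.
Qed.

End InnerProduct.

(** * The dimension formulas *)

Local Close Scope complex_scope.
Local Close Scope classical_set_scope.

Theorem proposition3p5 (R : realType) (n : nat) (hn : (1 <= n)%N)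
    (sigma : {finite_measure set (Srho R n) -> \bar R})
    (hsigma : is_polar_measure sigma) :
  [/\ forall m : nat,
        has_dim (spaceV R n m)
          ('C(m + 2 * n, 2 * n) + binz (m%:Z + (2 * n)%:Z - 2) (2 * n))%N,
      forall m : nat,
        has_dim (spaceW sigma m)
          ('C(m + 2 * n - 1, 2 * n - 1)
           + binz (m%:Z + (2 * n)%:Z - 3) (2 * n - 1))%N,
      Fps (fun m : nat => (vdim (spaceW sigma m))%:Z)
        = (1 + 'q ^+ 2) / (1 - 'q) ^+ (2 * n)
    & n = 1%N ->
      [/\ forall m : nat, has_dim (spaceV R n m) (m ^ 2 + m + 1)%N,
          has_dim (spaceW sigma 0) 1
        & forall m : nat, (1 <= m)%N -> has_dim (spaceW sigma m) (2 * m)%N]].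
Proof.
have dimV := @has_dim_spaceV R n; have dimW m := has_dim_spaceW hsigma m hn.
split.
- by move=> m; rewrite binz_sub2; exact: dimV.
- move=> m; rewrite -addnBA; last lia.
  have -> : m%:Z + (2 * n)%:Z - 3 = m%:Z + (2 * n - 1)%N%:Z - 2.
    by rewrite -subzn; [ring|lia].
  by rewrite binz_sub2; exact: dimW.
- have -> : (2 * n)%N = (2 * n - 1).+1 by lia.
  rewrite -fps_pair_count; congr Fps; apply/funext => m.
  by rewrite (has_dim_vdim (dimW m)).
move=> n1; split=> [m||m m0].
- have -> : (m ^ 2 + m + 1 = pair_count (2 * n) m)%N; last exact: dimV.
  rewrite n1; elim: m => [|m IH]; first by rewrite pair_count0.
  rewrite pair_countS -IH /pair_count !bin1.
  by case: m {IH} => [|m] /=; lia.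
- by rewrite -(pair_count0 (2 * n - 1)); exact: dimW.
have -> : (2 * m = pair_count (2 * n - 1) m)%N; last exact: dimW.
rewrite n1 /pair_count !bin1; case: m m0 => [|[|m]] //= _; lia.
Qed.
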